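(* Let $d\geq 2$ be an integer, $X$ a Polish space, and $A\subseteq X^d$ an analytic (i.e. $\mathbf{\Sigma}^1_1$) set. Then exactly one of the following holds: (a) $[X,A]\preceq_{B}[\omega,\neg\Delta^d(\omega)]$. (b) $[d^{\omega},\mathbb{A}_{d}]\preceq_{c}[X,A]$.
   Context: Here $\omega=\{0,1,2,\dots\}$ carries the discrete topology, $d=\{0,\dots,d-1\}$ is discrete, and $d^\omega$ has the product topology. $d^{<\omega}$ is the set of finite sequences of elements of $d$, $|s|$ is the length of $s$, juxtaposition denotes concatenation, and $0^k$ is the sequence of $k$ zeros. For a set $Y$, $\Delta^d(Y):=\{(y_i)_{i\in d}\in Y^d\mid \forall i\in d\ \ y_i=y_0\}$, and $\neg\Delta^d(\omega):=\omega^d\setminus\Delta^d(\omega)$. For a map $u:X\to Y$, $u^d:X^d\to Y^d$ is defined by $u^d[(x_i)_{i\in d}]:=(u(x_i))_{i\in d}$. For Polish spaces $X,Y$ and $A\subseteq X^d$, $B\subseteq Y^d$, we write $[X,A]\preceq_B[Y,B]$ (resp. $[X,A]\preceq_c[Y,B]$) if there is a Borel (resp. continuous) map $u:X\to Y$ with $A\subseteq (u^d)^{-1}(B)$. Let $\psi_d:\omega\to d^{<\omega}$ be the natural bijection enumerating finite sequences by increasing length: $\psi_d(0)=\emptyset$, $\psi_d(1)=0,\dots,\psi_d(d)=d-1$ (the sequences of length 1), then the sequences of length 2, and so on (lexicographically within each length). Then $|\psi_d(n)|\le n$, and we set $s^d_n:=\psi_d(n)0^{n-|\psi_d(n)|}$,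 a sequence of length $n$. Finally $$\mathbb{A}_d:=\{(s^d_n i\gamma)_{i\in d}\mid n\in\omega,\ \gamma\in d^\omega\}\subseteq (d^\omega)^d.$$ *)

(* Defs.v *)
From mathcomp Require Import all_boot all_order all_algebra.
From mathcomp Require Import all_classical all_reals all_analysis.

Set Implicit Arguments.
Unset Strict Implicit.
Unset Printing Implicit Defensive.

Import Order.TTheory GRing.Theory Num.Theory.
Local Open Scope classical_set_scope.
Local Open Scope ring_scope.

Definition is_distance (R : realType) (X : Type) (dist : X -> X -> R) : Prop :=
  [/\ forall x y, 0 <= dist x y,
      forall x y, dist x y = 0 <-> x = y,
      forall x y, dist x y = dist y x
    & forall x y z, dist x z <= dist x y + dist y z].

Definition compatible_distance (R : realType) (X : topologicalType)
    (dist : X -> X -> R) : Prop :=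
  forall (x : X) (U : set X),
    nbhs x U <-> exists2 e : R, 0 < e & [set y | dist x y < e] `<=` U.

Definition complete_distance (R : realType) (X : topologicalType)
    (dist : X -> X -> R) : Prop :=
  forall u : nat -> X,
    (forall e : R, 0 < e ->
       exists N : nat, forall m n : nat,
         (N <= m)%N -> (N <= n)%N -> dist (u m) (u n) < e) ->
    exists l : X, u @ \oo --> l.

(* Stated on a bare topologicalType with an unbundled distance: being Polish is
   a property of the topology, the metric is only required to exist, and no
   base point is assumed, so that the empty space is Polish. *)
Definition polish (R : realType) (X : topologicalType) : Prop :=
  (exists2 D : set X, countable D & dense D) /\
  (exists dist : X -> X -> R,
     [/\ is_distance dist, compatible_distance dist & complete_distance dist]).

(* Continuous images of Polish spaces; [set0] is the image of the empty one. *)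
Definition analytic (R : realType) (Z : topologicalType) (A : set Z) : Prop :=
  exists (Y : topologicalType) (f : Y -> Z),
    [/\ polish R Y, continuous f & A = range f].

(* The library's g_sigma_algebraType would require pointed spaces. *)
Definition borel_set (X : topologicalType) : set (set X) := <<s @open X >>.

Definition borel_map (X Y : topologicalType) (u : X -> Y) : Prop :=
  forall B : set Y, borel_set B -> borel_set (u @^-1` B).

Definition power (d : nat) (X : topologicalType) : topologicalType :=
  prod_topology (fun _ : 'I_d => X).

Definition map_power (d : nat) (X Y : topologicalType) (u : X -> Y)
  (x : power d X) : power d Y := fun i => u (x i).

Definition borel_reduces (d : nat) (X : topologicalType) (A : set (power d X))
    (Y : topologicalType) (B : set (power d Y)) : Prop :=
  exists2 u : X -> Y, borel_map u & A `<=` map_power u @^-1` B.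

Definition continuously_reduces (d : nat)
    (X : topologicalType) (A : set (power d X))
    (Y : topologicalType) (B : set (power d Y)) : Prop :=
  exists2 u : X -> Y, continuous u & A `<=` map_power u @^-1` B.

Definition zero (d : nat) (hd : (2 <= d)%N) : 'I_d := Ordinal (ltnW hd).

Definition diagonal_power (d : nat) (hd : (2 <= d)%N) (Y : topologicalType) :
  set (power d Y) := [set y | forall i, y i = y (zero hd)].

Definition infinite_words (d : nat) : topologicalType :=
  prod_topology (fun _ : nat => discrete_topology 'I_d).

(* The words of length l, in lexicographic order. *)
Fixpoint words (d l : nat) : seq (seq 'I_d) :=
  if l is l'.+1 then [seq i :: w | i <- enum 'I_d, w <- words d l']
  else [:: [::]].

(* The list of the words of length at most n, by increasing length, has more
   than n elements when 0 < d, so the default value is not reached. *)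
Definition psi (d n : nat) : seq 'I_d :=
  nth [::] (flatten [seq words d l | l <- iota 0 n.+1]) n.

Definition s_word (d : nat) (hd : (2 <= d)%N) (n : nat) : seq 'I_d :=
  psi d n ++ nseq (n - size (psi d n)) (zero hd).

Definition concat (d : nat) (w : seq 'I_d) (g : infinite_words d) :
  infinite_words d := fun k => nth (g (k - size w)%N) w k.

Definition A_set (d : nat) (hd : (2 <= d)%N) : set (power d (infinite_words d)) :=
  [set x | exists (n : nat) (g : infinite_words d),
     x = fun i => concat (rcons (s_word hd n) i) g].

(* Main.v *)
Require Import Defs.
From mathcomp Require Import all_boot all_order all_algebra.
From mathcomp Require Import all_classical all_reals all_analysis.
From mathcomp Require Import lra.

Set Implicit Arguments.
Unset Strict Implicit.
Unset Printing Implicit Defensive.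

Import Order.TTheory GRing.Theory Num.Theory.
Local Open Scope classical_set_scope.

(** Both alternatives cannot hold together, by Baire category. A continuous map
    from [d^omega] to [X] followed by a Borel map from [X] to [omega] colours
    [d^omega] in countably many colours whose classes have the Baire property, so
    one class is comeager in the cone of some word [s]. The words [s_n] are dense:
    some [s_n] extends [s]. All the sets of [g] such that [s_n i g] has that colour
    are then comeager, hence share a point [g], and [(s_n i g)_i] is a
    monochromatic element of [A_d] ([borel_coloring_obstruction]).

    That one alternative holds is proved with finite approximations to the map of
    the second one. Everything is coded in the Baire space: [X] is the image of a
    continuous map [p], and [A] is the range of a continuous map [F]. The first [n] words [s_k] turn the words of length [n] into a finite
    [d]-uniform hypergraph, with hyperedges [(s_k i t)_i]; a copy of it in [A]
    assigns to each word a code of a point of [X] and to each hyperedge a code of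
    an element of [A] that joins the points assigned to its vertices. A set of
    copies is small when countably many Borel [A]-independent sets are such that
    each copy in the set sends some vertex into one of them.

    At level [0] a copy is a point of [X]; if the set of all copies is small, then
    [X] is covered by countably many Borel independent sets, and the least index
    of one containing [x] is a Borel colouring of [X] ([coloring_reduces]).
    Otherwise the set is large, and two facts keep it so. A large set stays large
    after finitely many coordinates are fixed suitably ([large_refine]), because
    smallness is countably additive. And if the set [N] of copies near a given one
    is large, so is the set of copies of the next level made of [d] members of [N]
    joined by a new hyperedge at [s_n] ([large_successor]). Indeed, if the latter
    were small, witnessed by sets of union [C], then no hyperedge could join the
    members of [N] that avoid [C] at every vertex, so their values at [s_n] would
    form an independent set. That set is analytic, hence contained in a Borel
    independent set ([borel_independent_extension]), and [N] would be small.

    Iterating both facts gives a sequence of copies of all levels whose coordinates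
    settle along longer and longer words. The limits along the prefixes of [g] define
    the continuous map of the second alternative, and the limits of the
    coordinates of the hyperedges show that it sends [A_d] into [A]
    ([branch_reduces]). *)

(** * Words *)

Lemma mem_words (d l : nat) (w : seq 'I_d) : (w \in words d l) = (size w == l).
Proof.
elim: l w => [|l IH] [|i w] //=; first by apply/negP => /allpairsP[[? ?] []].
apply/allpairsP/idP => [[[j v] /= [_ vl [_ ->]]]|wl].
  by rewrite eqSS -IH.
by exists (i, w); split; rewrite ?mem_enum ?IH.
Qed.

Lemma size_psi (d n : nat) : (size (psi d n) <= n)%N.
Proof.
rewrite /psi; set F := flatten _.
have [lt_n|le_n] := ltnP n (size F); last by rewrite nth_default.
have /flatten_mapP[l] := mem_nth [::] lt_n.
by rewrite mem_iota mem_words add0n ltnS => /andP[_ ln] /eqP->.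
Qed.

Lemma leq_size_words_upto (d m : nat) : (0 < d)%N ->
  (m <= size (flatten [seq words d l | l <- iota 0 m]))%N.
Proof.
move=> d0; elim: m => // m IH.
rewrite -addn1 iotaD map_cat flatten_cat size_cat leq_add //= cats0.
have : nseq m (Ordinal d0) \in words d m by rewrite mem_words size_nseq.
by case: (words d m).
Qed.

(** The list of the words of length less than [m] is a prefix of the list for
    any larger bound, so the position of [s] in one of these lists is its position
    in all those that contain it. *)
Lemma psi_surj (d : nat) (s : seq 'I_d) : (0 < d)%N -> exists n, psi d n = s.
Proof.
move=> d0; pose F m := flatten [seq words d l | l <- iota 0 m].
have sF : s \in F (size s).+1.
  by apply/flatten_mapP; exists (size s);
    rewrite ?mem_words // mem_iota add0n ltnS leqnn.
exists (index s (F (size s).+1)); rewrite /psi -/(F _).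
set n := index _ _; have nth_n : nth [::] (F (size s).+1) n = s.
  exact: nth_index.
have FD a b : F (a + b)%N = F a ++ flatten [seq words d l | l <- iota a b].
  by rewrite /F iotaD map_cat flatten_cat.
have n_lt : (n < size (F (size s).+1))%N by rewrite index_mem.
have [/subnKC le|/ltnW/subnKC le] := leqP (size s).+1 n.+1.
  by rewrite -le FD nth_cat n_lt.
by rewrite -nth_n -[in RHS]le FD nth_cat (leq_size_words_upto n.+1 d0).
Qed.

Lemma size_s_word (d : nat) (hd : (2 <= d)%N) n : size (s_word hd n) = n.
Proof. by rewrite size_cat size_nseq subnKC // size_psi. Qed.

Lemma s_word_dense (d : nat) (hd : (2 <= d)%N) (s : seq 'I_d) :
  exists n r, s_word hd n = s ++ r.
Proof.
have [n <-] := psi_surj s (ltnW hd).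
by exists n, (nseq (n - size (psi d n)) (Defs.zero hd)).
Qed.

Lemma take_mkseq (T : Type) (f : nat -> T) k m :
  (k <= m)%N -> take k (mkseq f m) = mkseq f k.
Proof. by move=> km; rewrite /mkseq -map_take take_iota (minn_idPl km). Qed.

Lemma concat_cat d (s t : seq 'I_d) (g : infinite_words d) :
  concat (s ++ t) g = concat s (concat t g).
Proof.
apply/funext => k; rewrite /concat nth_cat size_cat.
have [ks|sk] := ltnP k (size s); first exact: set_nth_default.
by rewrite [RHS]nth_default // subnDA.
Qed.

Lemma mkseq_concat d (w : seq 'I_d) (g : infinite_words d) m :
  mkseq (concat w g) (size w + m) = w ++ mkseq g m.
Proof.
apply: (@eq_from_nth _ (g 0%N)) => [|k].
  by rewrite size_cat !size_mkseq.
rewrite size_mkseq => k_lt; rewrite nth_mkseq // nth_cat /concat.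
have [kw|wk] := ltnP k (size w); first exact: set_nth_default.
by rewrite nth_default // nth_mkseq // ltn_subLR.
Qed.

Lemma concat_mkseq d (g : infinite_words d) m :
  concat (mkseq g m) (fun k => g (m + k)%N) = g.
Proof.
apply/funext => k; rewrite /concat size_mkseq.
have [km|mk] := ltnP k m; first by rewrite nth_mkseq.
by rewrite nth_default ?size_mkseq // subnKC.
Qed.

Lemma nbhs_cylinder d (g : infinite_words d) (m : nat) :
  nbhs g [set g' : infinite_words d | mkseq g' m = mkseq g m].
Proof.
elim: m => [|m IH]; first by apply: filterS filterT.
have : nbhs g [set g' : infinite_words d | g' m = g m].
  have H := @proj_continuous nat (fun _ => discrete_topology 'I_d) m g.
  apply: (H [set x | x = g m]).
  by rewrite nbhs_principalE; apply/principal_filterP.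
move/(filterI IH); apply: filterS => g' [/= E1 E2].
by rewrite !mkseqS E1 E2.
Qed.

(** The filter generated by the cylinders around [g] converges to [g]
    coordinatewise, hence in the product topology. *)
Lemma nbhs_words d (g : infinite_words d) (U : set (infinite_words d)) :
  nbhs g U <->
  exists m, [set g' : infinite_words d | mkseq g' m = mkseq g m] `<=` U.
Proof.
split=> [|[m]]; last by move/filterS; apply; apply: nbhs_cylinder.
pose C m := [set g' : infinite_words d | mkseq g' m = mkseq g m].
have Cmono m m' : (m <= m')%N -> C m' `<=` C m.
  move=> mm' g' /= E.
  by rewrite /C /= -(take_mkseq _ mm') E take_mkseq.
pose F := filter_from [set: nat] C.
have FF : Filter F.
  apply: filter_from_filter; first by exists 0%N.
  move=> i j _ _; exists (maxn i j) => // g' Cg'.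
  by split; apply: (Cmono _ (maxn i j)); rewrite ?leq_maxl ?leq_maxr.
suff : F --> g by move=> Fg /Fg[m _ CU]; exists m.
apply/cvg_sup => i A; rewrite nbhsE /= => -[B [[V oV <-] Vg] BA].
exists i.+1 => // g' E; apply: BA; rewrite /= in Vg *.
suff -> : g' i = g i by [].
by move/(congr1 (nth (g 0%N) ^~ i)): E; rewrite !nth_mkseq.
Qed.

(** * Borel sets *)

Lemma borel_open (X : topologicalType) (U : set X) : open U -> borel_set U.
Proof. by move=> oU; apply: sub_sigma_algebra. Qed.

Lemma borel_setC (X : topologicalType) (B : set X) :
  borel_set B -> borel_set (~` B).
Proof. by move=> bB; rewrite -setTD; apply: sigma_algebraCD. Qed.

Lemma borel_bigcup (X : topologicalType) (I : countType) (B : I -> set X) :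
  (forall i, borel_set (B i)) -> borel_set (\bigcup_i B i).
Proof.
move=> Bb; pose B' n := if unpickle n is Some i then B i else set0.
have -> : \bigcup_i B i = \bigcup_n B' n.
  apply/seteqP; split=> x [i _ Bx]; last first.
    by move: Bx; rewrite /B'; case: unpickle => // j Bx; exists j.
  by exists (pickle i) => //; rewrite /B' pickleK.
apply: sigma_algebra_bigcup => n; rewrite /B'.
by case: unpickle => [i|]; [apply: Bb|apply: sigma_algebra0].
Qed.

Lemma borel_bigcap (X : topologicalType) (I : countType) (B : I -> set X) :
  (forall i, borel_set (B i)) -> borel_set (\bigcap_i B i).
Proof.
move=> Bb; rewrite -[X in borel_set X]setCK setC_bigcap.
by apply: borel_setC; apply: borel_bigcup => i; apply: borel_setC.
Qed.

Lemma borel_set_ind (X : topologicalType) (P : set X -> Prop) :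
  (forall U, open U -> P U) -> (forall B, P B -> P (~` B)) ->
  (forall B : nat -> set X, (forall n, P (B n)) -> P (\bigcup_n B n)) ->
  forall B, borel_set B -> P B.
Proof.
move=> Popen PC Pcup B0 bB0; apply: (bB0 P); split; last by move=> U; apply: Popen.
split=> [|B PB|B]; first exact/Popen/open0; last exact: Pcup.
by rewrite setTD; apply: PC.
Qed.

(** * Continuity on the Baire space *)

Definition agree (m : nat) (a b : nat -> nat) := forall k, (k < m)%N -> a k = b k.

Lemma agree_leq m m' a b : (m <= m')%N -> agree m' a b -> agree m a b.
Proof. by move=> mm' ab k km; apply: ab; apply: leq_trans mm'. Qed.

Lemma agree_sym m a b : agree m a b -> agree m b a.
Proof. by move=> ab k /ab. Qed.

Lemma agree_reindex (idx : nat -> nat) (m : nat) :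
  exists m', forall a b, agree m' a b -> agree m (a \o idx) (b \o idx).
Proof.
exists (\max_(k < m) (idx k).+1) => a b ab k km /=; apply: ab.
by rewrite (leq_bigmax (Ordinal km)).
Qed.

(** Continuity for the product topology on [nat -> nat], read on finite parts of
    sequences. *)
Definition baire_continuous (X : topologicalType) (f : (nat -> nat) -> X) :=
  forall a U, nbhs (f a) U -> exists m, forall b, agree m a b -> U (f b).

Lemma baire_continuous_comp (X Y : topologicalType) (f : (nat -> nat) -> X)
    (g : X -> Y) :
  baire_continuous f -> continuous g -> baire_continuous (g \o f).
Proof. by move=> fc gc a U /gc /fc. Qed.

Lemma baire_continuous_reindex (X : topologicalType) (f : (nat -> nat) -> X) idx :
  baire_continuous f -> baire_continuous (fun a => f (a \o idx)).
Proof.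
move=> fc a U /fc[m fm]; have [m' idxm] := agree_reindex idx m.
by exists m' => b /idxm /fm.
Qed.

Arguments baire_continuous_reindex {X f} idx _ {a U} _.

(** * Polish spaces as images of the Baire space *)

Section Metric.
Context (R : realType) (X : topologicalType) (dist : X -> X -> R).
Hypothesis dist_axioms : is_distance dist.
Hypothesis dist_compat : compatible_distance dist.
Local Open Scope ring_scope.

Lemma dist_refl x : dist x x = 0.
Proof. by have [_ /(_ x x) [_ ->]] := dist_axioms. Qed.

Lemma nbhs_ball x (e : R) : 0 < e -> nbhs x [set y | dist x y < e].
Proof. by move=> e0; apply/dist_compat; exists e. Qed.

Lemma separate_points x y : x <> y ->
  exists U V : set X, [/\ open U, U x, open V, V y & U `&` V = set0].
Proof.
move=> xy; have [dist0 dist_eq dist_sym dist_tri] := dist_axioms.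
have dxy : 0 < dist x y.
  by rewrite lt_def dist0 andbT; apply/eqP => /dist_eq.
have half0 : 0 < dist x y / 2 by rewrite divr_gt0.
exists (interior [set z | dist x z < dist x y / 2]).
exists (interior [set z | dist y z < dist x y / 2]).
split; do ?[exact: open_interior|exact: nbhs_ball].
apply/seteqP; split=> // z [/interior_subset /= xz /interior_subset /= yz].
have := dist_tri x z y; rewrite (dist_sym z y); lra.
Qed.

Lemma open_Fsigma (U : set X) : open U ->
  exists F : nat -> set X, (forall n, closed (F n)) /\ U = \bigcup_n F n.
Proof.
have [dist0 dist_eq dist_sym dist_tri] := dist_axioms => oU.
(* Points at distance at least 1/(n+1) from the complement of U. *)
pose F n := [set x | forall y, dist x y < n.+1%:R^-1 -> U y].
exists F; split=> [n|].
  rewrite -[F n]setCK; apply: open_closedC; rewrite openE => x /= Fx.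
  have [y] : exists y, ~ (dist x y < n.+1%:R^-1 -> U y).
    by apply: contrapT => /forallNP H; apply: Fx => y; apply: contrapT.
  move=> /not_implyP [xy nUy].
  have e0 : 0 < n.+1%:R^-1 - dist x y by rewrite subr_gt0.
  apply: filterS (nbhs_ball x e0) => z /= xz Fz; apply: nUy; apply: Fz.
  apply: le_lt_trans (dist_tri z x y) _.
  by rewrite (dist_sym z x) -ltrBrDr.
apply/seteqP; split=> [x Ux|x [n _ Fx]]; last first.
  by apply: Fx; rewrite dist_refl.
have /dist_compat[e e0 eU] : nbhs x U by apply: open_nbhs_nbhs.
exists (Num.truncn e^-1) => // y xy; apply: eU => /=; apply: lt_trans xy _.
by rewrite invf_plt ?posrE //; apply: truncnS_gt.
Qed.

End Metric.

Lemma polish_separated (R : realType) (X : topologicalType) (x y : X) :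
  polish R X -> x <> y ->
  exists U V : set X, [/\ open U, U x, open V, V y & U `&` V = set0].
Proof. by move=> [_ [dist [dm dc _]]]; apply: (separate_points dm dc). Qed.

Lemma polish_Fsigma (R : realType) (X : topologicalType) (U : set X) :
  polish R X -> open U ->
  exists F : nat -> set X, (forall n, closed (F n)) /\ U = \bigcup_n F n.
Proof. by move=> [_ [dist [dm dc _]]]; apply: (open_Fsigma dm dc). Qed.

Section PolishImage.
Context (R : realType) (X : topologicalType) (dist : X -> X -> R).
Hypothesis dist_axioms : is_distance dist.
Hypothesis dist_compat : compatible_distance dist.
Hypothesis dist_complete : complete_distance dist.
Context (q : nat -> X).
Hypothesis q_dense : forall x (e : R), (0 < e)%R -> exists k, (dist x (q k) < e)%R.
Local Open Scope ring_scope.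

Let step n : R := 2^-1 ^+ n.

Let step_gt0 n : 0 < step n.
Proof. by rewrite exprn_gt0. Qed.

Let stepS n : step n = step n.+1 + step n.+1.
Proof. by rewrite /step exprS; lra. Qed.

Let step_small (e : R) : 0 < e -> exists n, step n < e.
Proof.
move=> e0; exists (Num.truncn e^-1); rewrite /step exprVn invf_plt ?posrE //.
apply: lt_le_trans (truncnS_gt _) _; rewrite -natrX ler_nat.
exact: ltn_expl.
Qed.

(** A move is made only when it is shorter than [step n'], so that every code
    gives a Cauchy sequence: the map from codes to limits is total. *)
Fixpoint dense_walk (a : nat -> nat) (n : nat) : X :=
  if n is n'.+1 then
    let y := dense_walk a n' in
    let z := q (a n) in if dist y z < step n' then z else y
  else q (a 0%N).

Let walk_step a n : dist (dense_walk a n) (dense_walk a n.+1) < step n.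
Proof. by rewrite /=; case: ifP => // _; rewrite (dist_refl dist_axioms). Qed.

Let walk_dist a n m : (n <= m)%N ->
  dist (dense_walk a n) (dense_walk a m) <= step n + step n - (step m + step m).
Proof.
have [_ _ _ tri] := dist_axioms.
move=> /subnK <-; elim: (m - n)%N => [|k IH].
  by rewrite add0n (dist_refl dist_axioms) subrr.
apply: le_trans (tri _ (dense_walk a (k + n)) _) _.
have := walk_step a (k + n); rewrite addSn (stepS (k + n)) in IH *.
lra.
Qed.

Let walk_limit a : exists l : X, dense_walk a @ \oo --> l.
Proof.
have [_ _ sym tri] := dist_axioms.
apply: dist_complete => e e0; have [N Ne] := step_small e0.
exists N.+2 => m n Nm Nn.
apply: le_lt_trans (tri _ (dense_walk a N.+2) _) _.
have := walk_dist a Nm; rewrite sym.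
have := walk_dist a Nn; have := step_gt0 m; have := step_gt0 n.
have := stepS N.+1; have := stepS N; lra.
Qed.

Definition walk_end a : X := sval (cid (walk_limit a)).

Let walk_end_dist a n : dist (dense_walk a n) (walk_end a) <= step n + step n.
Proof.
have [_ _ sym tri] := dist_axioms.
apply/ler_addgt0Pr => e e0; rewrite /walk_end; case: cid => /= l wl.
have [N _ /(_ (maxn n N) (leq_maxr _ _)) /= lw] := wl _ (nbhs_ball dist_compat l e0).
apply: le_trans (tri _ (dense_walk a (maxn n N)) _) _.
have := walk_dist a (leq_maxl n N); rewrite (sym _ l).
have := step_gt0 (maxn n N); lra.
Qed.

Let walk_end_continuous : baire_continuous walk_end.
Proof.
have [_ _ sym tri] := dist_axioms.
move=> a U /dist_compat[e e0 eU]; have [n ne] := step_small e0.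
have wE m b : agree m.+1 a b -> dense_walk a m = dense_walk b m.
  elim: m => [|m IH] ab /=; first by rewrite ab.
  by rewrite IH ?ab //; apply: agree_leq ab.
exists n.+4 => b /wE ab; apply: eU => /=.
apply: le_lt_trans (tri _ (dense_walk a n.+3) _) _.
have := walk_end_dist a n.+3; rewrite sym.
have := walk_end_dist b n.+3; rewrite -ab.
have := step_gt0 n.+3; have := stepS n.+2; have := stepS n.+1; have := stepS n; lra.
Qed.

Let walk_end_surj x : exists a, walk_end a = x.
Proof.
have [dist0 dist_eq sym tri] := dist_axioms.
have /choice[a aP] : forall n, exists k, dist x (q k) < step n.+2.
  by move=> n; apply: q_dense.
have wE n : dense_walk a n = q (a n).
  elim: n => //= n ->; rewrite ifT //.
  apply: le_lt_trans (tri _ x _) _; rewrite (sym _ x).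
  have := aP n; have := aP n.+1; have := step_gt0 n.+3.
  have := stepS n.+2; have := stepS n.+1; have := stepS n; lra.
exists a; apply/dist_eq/le_anti; rewrite dist0 andbT.
apply/ler_addgt0Pr => e e0; rewrite add0r.
have [n ne] := step_small e0.
apply: le_trans (tri _ (dense_walk a n.+2) _) _.
have := walk_end_dist a n.+2; rewrite sym wE => h; have := aP n.+2; rewrite sym.
have := step_gt0 n; have := step_gt0 n.+4.
have := stepS n.+3; have := stepS n.+2; have := stepS n.+1; have := stepS n; lra.
Qed.

(** The limit is within [2 * step n] of the [n]-th position, which only depends
    on finitely many terms of the code; and a point [x] is reached along points of
    the dense sequence that are closer to [x] than the allowed steps. *)
Lemma dense_walk_image :
  exists p : (nat -> nat) -> X, baire_continuous p /\ forall x, exists a, p a = x.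
Proof. by exists walk_end. Qed.

End PolishImage.

Lemma polish_baire_image (R : realType) (X : topologicalType) (x0 : X) :
  polish R X ->
  exists p : (nat -> nat) -> X, baire_continuous p /\ forall x, exists a, p a = x.
Proof.
move=> [[D cD dD] [dist [dm dc dcomp]]].
have meetD x (e : R) : (0 < e)%R -> exists2 y, D y & (dist x y < e)%R.
  move=> e0; have xn := nbhs_ball dc x e0.
  have [y [/interior_subset xy Dy]] : interior [set y | (dist x y < e)%R] `&` D !=set0.
    by apply: dD; [exists x | exact: open_interior].
  by exists y.
have [y0 Dy0 _] := meetD x0 1%R ltr01.
(* An enumeration of D; indices that code no point of D are sent to y0. *)
have [q qD] : exists q : nat -> X, D `<=` range q.
  have /pcard_leP/unsquash f : (D #<= [set: nat])%card by [].
  pose g n : X := if pselect (exists2 y, D y & f y = n) is left h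
                  then s2val (cid2 h) else y0.
  exists g => y Dy; exists (f y) => //; rewrite /g.
  case: pselect => [h|]; last by case; exists y.
  case: cid2 => z Dz fz /=; apply: (@inj _ _ _ f) => //; exact/mem_set.
apply: (@dense_walk_image R X dist dm dc dcomp q) => x e /(meetD x)[y /qD[k _ <-] xy].
by exists k.
Qed.

(** * Souslin form of the Borel sets *)

(** The Souslin normal form of an analytic set: a projection along the Baire
    space of a countable intersection of sets that are closed in [X] and
    depend on a finite part of the code. *)
Definition souslin (X : topologicalType) (P : set X) :=
  exists F : nat -> (nat -> nat) -> set X,
  [/\ forall n a, closed (F n a),
      forall n a, exists m, forall b, agree m a b -> F n b = F n a
    & P = [set x | exists a, forall n, F n a x]].

Lemma souslin_closed (X : topologicalType) (C : set X) : closed C -> souslin C.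
Proof.
move=> cC; exists (fun _ _ => C); split=> //; first by exists 0%N.
by apply/seteqP; split=> [x Cx|x [_ /(_ 0%N)]] //; exists id.
Qed.

(** A point of the intersection has one code for each set; a pairing function
    merges them into a single code. *)
Lemma souslin_bigcap (X : topologicalType) (P : nat -> set X) :
  (forall n, souslin (P n)) -> souslin (\bigcap_n P n).
Proof.
move=> /choice[F FP].
pose part (j : nat) (a : nat -> nat) := a \o (fun k : nat => pickle (j, k)).
pose G n a := if @unpickle (nat * nat)%type n is Some (j, i)
  then F j i (part j a) else setT.
exists G; split=> [n a|n a|].
- rewrite /G; case: unpickle => [[j i]|]; last exact: closedT.
  by have [+ _ _] := FP j; apply.
- rewrite /G; case: unpickle => [[j i]|]; last by exists 0%N.
  have [_ /(_ i (part j a))[m Fm] _] := FP j.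
  have [m' mm'] := agree_reindex (fun k : nat => pickle (j, k)) m.
  by exists m' => b /mm' /Fm.
- apply/seteqP; split=> [x Px|x [a Gx] j _].
    have /choice[a ax] : forall j, exists a, forall n, F j n a x.
      by move=> j; have := Px j I; have [_ _ ->] := FP j.
    pose merged k := if @unpickle (nat * nat)%type k is Some (j, i)
      then a j i else 0%N.
    have part_merged j : part j merged = a j.
      by apply/funext => k; rewrite /part /merged /= pickleK.
    exists merged => n; rewrite /G; case: unpickle => // -[j i].
    by rewrite part_merged.
  have [_ _ ->] := FP j; exists (part j a) => n.
  by have := Gx (pickle (j, n)); rewrite /G pickleK.
Qed.

(** The first term of the code says which of the sets the point belongs to. *)
Lemma souslin_bigcup (X : topologicalType) (P : nat -> set X) :
  (forall n, souslin (P n)) -> souslin (\bigcup_n P n).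
Proof.
move=> /choice[F FP].
exists (fun n a => F (a 0%N) n (a \o succn)); split=> [n a|n a|].
- by have [+ _ _] := FP (a 0%N); apply.
- have [_ /(_ n (a \o succn))[m Fm] _] := FP (a 0%N).
  by exists m.+1 => b ab; rewrite -(ab 0%N) // Fm // => k km /=; apply: ab.
- apply/seteqP; split=> [x [j _]|x [a Gx]].
    have [_ _ -> [a ax]] := FP j.
    by exists (fun k => if k is k'.+1 then a k' else j).
  by exists (a 0%N) => //; have [_ _ ->] := FP (a 0%N); exists (a \o succn).
Qed.

(** The sets that are Souslin together with their complement form a
    sigma-algebra, which contains the open sets since these are F-sigma. *)
Lemma borel_souslin (R : realType) (X : topologicalType) (B : set X) :
  polish R X -> borel_set B -> souslin B.
Proof.
move=> pX bB; suff [] : souslin B /\ souslin (~` B) by [].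
elim/borel_set_ind: bB => {B} [U oU|B [sB sCB]|B sB].
- split; last by apply/souslin_closed/open_closedC.
  have [F [cF ->]] := polish_Fsigma pX oU.
  by apply: souslin_bigcup => n; apply: souslin_closed.
- by rewrite setCK.
- split; first by apply: souslin_bigcup => n; have [] := sB n.
  by rewrite setC_bigcup; apply: souslin_bigcap => n; have [] := sB n.
Qed.

(** * Sequences of successive choices *)

Lemma dependent_choice_nat (T : Type) (P : nat -> T -> Prop)
    (Q : nat -> T -> T -> Prop) (t0 : T) :
  P 0%N t0 -> (forall n t, P n t -> exists2 t', P n.+1 t' & Q n t t') ->
  exists s : nat -> T, forall n, P n (s n) /\ Q n (s n) (s n.+1).
Proof.
move=> P0 PS.
have /choice[next nextP] : forall p : nat * T, exists t',
    P p.1 p.2 -> P p.1.+1 t' /\ Q p.1 p.2 t'.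
  move=> [n t] /=; have [/PS[t' Pt' Qt']|nP] := pselect (P n t); first by exists t'.
  by exists t.
pose s := fix s n := if n is n'.+1 then next (n', s n') else t0.
have Ps n : P n (s n) by elim: n => //= n IH; case: (nextP (n, s n) IH).
by exists s => n; split=> //; case: (nextP (n, s n) (Ps n)).
Qed.

(** The diagonal is the limit of a sequence whose [m]-th term has settled below
    [m]. *)
Lemma agree_diagonal (s : nat -> nat -> nat) :
  (forall m, agree m (s m) (s m.+1)) ->
  forall m, agree m (s m) (fun k => s k.+1 k).
Proof.
move=> ss m k; elim: m => // m IH; rewrite ltnS leq_eqVlt => /orP[/eqP->//|km].
by rewrite -IH // -ss.
Qed.

(** * Separation of an independent analytic set *)

Definition baire_closed (K : set (nat -> nat)) :=
  forall a, ~ K a -> exists m, forall b, agree m a b -> ~ K b.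

Section Separation.
Context (R : realType) (d : nat) (X : topologicalType).
Hypothesis pX : polish R X.
Context (K : set (nat -> nat)) (g : (nat -> nat) -> X) (F : (nat -> nat) -> power d X).
Hypothesis K_closed : baire_closed K.
Hypothesis g_continuous : baire_continuous g.
Hypothesis F_continuous : forall i, baire_continuous (fun b => F b i).

(** Separation restricted to a box of codes. The [d] copies of [g @` K] are
    given different Borel sets, because they are refined independently. *)
Let sep m (a : 'I_d -> nat -> nat) (b : nat -> nat) :=
  exists B : 'I_d -> set X,
  [/\ forall i, borel_set (B i),
      forall i a', agree m (a i) a' -> K a' -> B i (g a')
    & forall b', agree m b b' -> exists i, ~ B i (F b' i)].

Let upd (a : nat -> nat) (m v k : nat) : nat := if k == m then v else a k.

Let agree_upd m a a' : agree m a a' -> agree m.+1 (upd a m (a' m)) a'.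
Proof.
by move=> aa' k; rewrite ltnS leq_eqVlt /upd; case: eqP => //= [->|_ /aa'].
Qed.

Let agree_updr m a v : agree m a (upd a m v).
Proof. by move=> k km; rewrite /upd ltn_eqF. Qed.

(** A box that cannot be separated has a sub-box, with one more term fixed in
    each code, that cannot be separated either. *)
Let sep_glue m a b :
  (forall (v : {ffun 'I_d -> nat}) w,
     sep m.+1 (fun i => upd (a i) m (v i)) (upd b m w)) -> sep m a b.
Proof.
move=> sepS.
have /choice[B BP] : forall p : {ffun 'I_d -> nat} * nat, exists B : 'I_d -> set X,
    [/\ forall i, borel_set (B i),
        forall i a', agree m.+1 (upd (a i) m (p.1 i)) a' -> K a' -> B i (g a')
      & forall b', agree m.+1 (upd b m p.2) b' -> exists i, ~ B i (F b' i)].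
  by move=> [v w]; apply: sepS.
(* The i-th set keeps all points of g @` K whose code continues with n, since the
   intersection is over the sub-boxes where the i-th code does. A value of F with
   its coordinates in these sets chooses an n for each i, hence one sub-box, whose
   separating sets exclude it. *)
exists (fun i => \bigcup_(n : nat)
  \bigcap_(p : {ffun 'I_d -> nat} * nat) if p.1 i == n then B p i else setT).
split=> [i|i a' aa' Ka'|b' bb'].
- apply: borel_bigcup => n; apply: borel_bigcap => p.
  by case: ifP => _; [have [+ _ _] := BP p|apply: borel_open; exact: openT].
- exists (a' m) => // p _; case: eqP => // pi; have [_ + _] := BP p; apply=> //.
  by rewrite pi; apply: agree_upd.
- apply: contrapT => /forallNP noi.
  have /choice[n nP] : forall i, exists n : nat, forall p : {ffun 'I_d -> nat} * nat,
      p.1 i = n -> B p i (F b' i).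
    move=> i; have /contrapT[n _ nP] := noi i.
    by exists n => p /eqP pn; have := nP p I; rewrite pn.
  have [_ _ /(_ b' (agree_upd bb'))[i]] := BP ([ffun i => n i], b' m).
  by apply; apply: nP; rewrite /= ffunE.
Qed.

(** If separation failed, the refinement would go on forever and produce
    limit codes. Either some limit is outside the closed set [K], or the value
    of [F] and those of [g] at the limits differ in some coordinate. A box small
    enough is then separated trivially, or by two disjoint open sets. *)
Let sep0 a b :
  (forall b (a : 'I_d -> nat -> nat), (forall i, K (a i)) ->
     exists i, F b i <> g (a i)) -> sep 0 a b.
Proof.
move=> Fg; apply: contrapT => nsep.
have [s sP] : exists s : nat -> ('I_d -> nat -> nat) * (nat -> nat), forall n,
    ~ sep n (s n).1 (s n).2 /\
    ((forall i, agree n ((s n).1 i) ((s n.+1).1 i)) /\ agree n (s n).2 (s n.+1).2).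
  apply: (@dependent_choice_nat _ (fun n t => ~ sep n t.1 t.2) (fun n t t' =>
    (forall i, agree n (t.1 i) (t'.1 i)) /\ agree n t.2 t'.2) (a, b)) => //.
  move=> n t nst; apply: contrapT => nex; apply: nst; apply: sep_glue => v w.
  apply: contrapT => nst; apply: nex.
  exists (fun i => upd (t.1 i) n (v i), upd t.2 n w) => //.
  by split=> [i|]; apply: agree_updr.
pose la i k := (s k.+1).1 i k; pose lb k := (s k.+1).2 k.
have las m i : agree m ((s m).1 i) (la i).
  by apply: (@agree_diagonal (fun m => (s m).1 i)) => n; have [_ []] := sP n.
have lbs m : agree m (s m).2 lb.
  by apply: (@agree_diagonal (fun m => (s m).2)) => n; have [_ []] := sP n.
have trans m x y z : agree m x y -> agree m x z -> agree m y z.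
  by move=> xy xz k km; rewrite -xy // xz.
pose only (i : 'I_d) (V : set X) (j : 'I_d) := if j == i then V else setT.
have only_borel i V : borel_set V -> forall j, borel_set (only i V j).
  by move=> bV j; rewrite /only; case: ifP => // _; apply: borel_open; exact: openT.
have [/Fg|/existsNP[i nK]] := pselect (forall i, K (la i)).
  move=> /(_ lb)[i /(polish_separated pX)[U [V [oU UF oV Vg UV]]]].
  have [m mF] := F_continuous (open_nbhs_nbhs (conj oU UF)).
  have [m' mg] := g_continuous (open_nbhs_nbhs (conj oV Vg)).
  have [+ _] := sP (maxn m m'); apply; exists (only i V).
  split=> [|j a' aa' _|b' bb']; first by apply: only_borel; apply: borel_open.
    rewrite /only; case: eqP => // ji; apply: mg; rewrite -ji.
    exact: agree_leq (leq_maxr m m') (trans _ _ _ _ (las _ _) aa').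
  exists i; rewrite /only eqxx => VF.
  suff : (U `&` V) (F b' i) by rewrite UV.
  split=> //; apply: mF.
  exact: agree_leq (leq_maxl m m') (trans _ _ _ _ (lbs _) bb').
have [m mK] := K_closed nK.
have [+ _] := sP m; apply; exists (only i set0).
split=> [|j a' aa' Ka'|b' bb'].
- by apply: only_borel; apply: borel_open; exact: open0.
- rewrite /only; case: eqP => // ji; apply: mK Ka'; rewrite -ji.
  exact: trans (las _ _) aa'.
- by exists i; rewrite /only eqxx.
Qed.

(** Lusin separation for hypergraphs: when no value of [F] has all its
    coordinates in the analytic set [g @` K], the same holds for some Borel
    superset. Intersecting the separating sets of the [d] coordinates gives one
    set for all of them. *)
Lemma borel_independent_extension :
  (forall b (a : 'I_d -> nat -> nat), (forall i, K (a i)) ->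
     exists i, F b i <> g (a i)) ->
  exists B, [/\ borel_set B, forall a, K a -> B (g a)
              & forall b, exists i, ~ B (F b i)].
Proof.
move=> Fg; have [B [bB KB BF]] := sep0 (fun _ _ => 0%N) (fun _ => 0%N) Fg.
exists (\bigcap_i B i); split=> [|a Ka i _|b]; first exact: borel_bigcap.
  exact: KB.
have [//|i nBi] := BF b; exists i => bigB; exact/nBi/bigB.
Qed.

End Separation.

(** * Copies of the finite hypergraphs *)

Section Construction.
Context (R : realType) (d : nat) (hd : (2 <= d)%N) (X : topologicalType).
Hypothesis pX : polish R X.
Context (p : (nat -> nat) -> X) (F : (nat -> nat) -> power d X).
Hypothesis p_continuous : baire_continuous p.
Hypothesis F_continuous : forall i, baire_continuous (fun b => F b i).

Definition borel_independent (B : set X) :=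
  borel_set B /\ forall b, exists i, ~ B (F b i).

(** Codes for a copy. Words are written backwards, so that appending a letter at
    the end is [cons]: [h None t] codes the point at the vertex [rev t], and
    [h (Some k) t] codes the element of the range of [F] at the hyperedge of the
    words [s_k i (rev t)]. The coordinate [(o, t)] belongs to level [n] when
    [rank o + size t = n], and the other ones are left free. *)
Definition labelling := option nat -> seq 'I_d -> nat -> nat.

Definition rank (o : option nat) : nat := if o is Some k then k.+1 else 0.

Definition child (i : 'I_d) (h : labelling) : labelling := fun o t => h o (i :: t).

(** At level [n.+1] the only hyperedge that is not inside one of the [d] parts is
    the one indexed by [n] and the empty word. *)
Definition join (hs : 'I_d -> labelling) (b : nat -> nat) : labelling :=
  fun o t => if t is i :: t' then hs i o t' else b.

Definition is_copy n (h : labelling) := forall k t, (k.+1 + size t = n)%N ->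
  forall i, F (h (Some k) t) i = p (h None (t ++ i :: rev (s_word hd k))).

Definition close_copy n (c h : labelling) := forall o t k,
  (rank o + size t = n)%N -> (k < n)%N -> h o t k = c o t k.

Definition small n (H : set labelling) := exists B : nat -> set X,
  (forall j, borel_independent (B j)) /\
  forall h, H h -> exists j s, size s = n /\ B j (p (h None s)).

Lemma small_subset n (H H' : set labelling) : H `<=` H' -> small n H' -> small n H.
Proof. by move=> HH' [B [cB BH]]; exists B; split=> // h /HH' /BH. Qed.

Lemma small_bigcup n (H : nat -> set labelling) :
  (forall v, small n (H v)) -> small n (\bigcup_v H v).
Proof.
move=> /choice[B BP].
pose B' m := if @unpickle (nat * nat)%type m is Some (v, j) then B v j else B 0 0.
exists B'; split=> [m|h [v _ Hh]].
  by rewrite /B'; case: unpickle => [[v j]|]; [have [+ _] := BP v|have [+ _] := BP 0];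
    apply.
have [_ /(_ h Hh)[j [s [sn Bh]]]] := BP v.
by exists (pickle (v, j)), s; rewrite /B' pickleK.
Qed.

Lemma large_nonempty n (H : set labelling) : ~ small n H -> H !=set0.
Proof.
move=> largeH; apply: contrapT => /forallNP H0; apply: largeH.
exists (fun=> set0); split=> [j|h /H0 //].
split; first by apply: borel_open; exact: open0.
by move=> b; exists (Defs.zero hd).
Qed.

(** Coordinates are fixed one at a time: each splits the set into countably many
    parts, of which one is large. A large set is nonempty, so [c] can be taken in
    the set itself. *)
Lemma large_refine n (H : set labelling) (L : seq (option nat * seq 'I_d * nat)) :
  ~ small n H ->
  exists2 c, H c & ~ small n (H `&`
    [set h | forall o t k, (o, t, k) \in L -> h o t k = c o t k]).
Proof.
move=> largeH; elim: L => [|[[w0 t0] k0] L [c Hc largec]].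
  have [c Hc] := large_nonempty largeH.
  by exists c => //; apply: contra_not largeH; apply: small_subset => h Hh; split.
set Hc' := H `&` _ in largec.
have [v largev] : exists v, ~ small n (Hc' `&` [set h | h w0 t0 k0 = v]).
  apply: contrapT => /forallNP H0; apply: largec.
  apply: (@small_subset _ _ (\bigcup_v (Hc' `&` [set h | h w0 t0 k0 = v]))).
    by move=> h Hh; exists (h w0 t0 k0).
  by apply: small_bigcup => v; apply: contrapT.
have [h0 [[Hh0 h0c] h0v]] := large_nonempty largev.
exists h0 => //; apply: contra_not largev; apply: small_subset => h [[Hh hc] hv].
split=> // o t k; rewrite inE => /orP[/eqP[-> -> ->]|okL].
  by rewrite hv h0v.
by rewrite hc // h0c.
Qed.

(** Fixing the first [n] values of the level [n] coordinates is a finite number of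
    conditions. *)
Lemma finite_level n : exists L : seq (option nat * seq 'I_d * nat),
  forall o t k, (rank o + size t = n)%N -> (k < n)%N -> (o, t, k) \in L.
Proof.
pose os := None :: [seq Some k | k <- iota 0 n].
pose ts := flatten [seq words d l | l <- iota 0 n.+1].
exists (allpairs pair (allpairs pair os ts) (iota 0 n)) => o t k otn kn.
apply: allpairs_f; last by rewrite mem_iota.
apply: allpairs_f; last first.
  apply/flatten_mapP; exists (size t); rewrite ?mem_words // mem_iota add0n ltnS.
  by rewrite -otn leq_addl.
case: o otn => [j|] /= jn; rewrite inE //=; apply: map_f.
by rewrite mem_iota /= add0n -jn addSn ltnS leq_addr.
Qed.

Lemma join_copy n (hs : 'I_d -> labelling) b :
  (forall i, is_copy n (hs i)) ->
  (forall i, F b i = p (hs i None (rev (s_word hd n)))) ->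
  is_copy n.+1 (join hs b).
Proof.
move=> copyh Fb k [|j t] /= ktn i.
  by move: ktn; rewrite addn0 => -[->].
by apply: copyh; move: ktn; rewrite addnS => -[].
Qed.

(** The copies near [c] that avoid the Borel set [C], each given with Souslin
    codes for this avoidance, form a closed set once all the data are packed in
    one sequence; their values at [s_n] therefore form an analytic set. *)
Lemma avoiding_image_extension n c (C : set X) : borel_set C ->
  (forall hs b,
     (forall i, is_copy n (hs i) /\ close_copy n c (hs i) /\
        forall s, size s = n -> ~ C (p (hs i None s))) ->
     exists i, F b i <> p (hs i None (rev (s_word hd n)))) ->
  exists B, borel_independent B /\
    forall h, is_copy n h -> close_copy n c h ->
      (forall s, size s = n -> ~ C (p (h None s))) ->
      B (p (h None (rev (s_word hd n)))).
Proof.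
move=> bC Fh; have [S [Sclosed Slocal SE]] := borel_souslin pX (borel_setC bC).
pose index := ((option nat * seq 'I_d * nat) + (seq 'I_d * nat))%type.
pose vidx (o : option nat) (t : seq 'I_d) (k : nat) := @pickle index (inl (o, t, k)).
pose sidx (s : seq 'I_d) (k : nat) := @pickle index (inr (s, k)).
pose lab (a : nat -> nat) : labelling := fun o t => a \o vidx o t.
pose wit (a : nat -> nat) s := a \o sidx s.
(* The codes wit a s certify that the point at s is outside C. *)
pose K := [set a | is_copy n (lab a) /\ close_copy n c (lab a) /\
  forall s, size s = n -> forall m, S m (wit a s) (p (lab a None s))].
have Kclosed : baire_closed K.
  move=> a; rewrite /K /= !not_andP => -[nK|[nK|nK]].
  - have [k /existsNP[t /not_implyP[ktn /existsNP[i ne]]]] :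
        exists k, ~ forall t, (k.+1 + size t)%N = n -> forall i,
        F (lab a (Some k) t) i = p (lab a None (t ++ i :: rev (s_word hd k))).
      exact/existsNP.
    have [U [V [oU UF oV Vp UV]]] := polish_separated pX ne.
    have [m mF] := baire_continuous_reindex (vidx (Some k) t) (@F_continuous i)
      (open_nbhs_nbhs (conj oU UF)).
    have [m' mp] := baire_continuous_reindex (vidx None _) p_continuous
      (open_nbhs_nbhs (conj oV Vp)).
    exists (maxn m m') => b ab [copyb _].
    suff : (U `&` V) (F (lab b (Some k) t) i) by rewrite UV.
    split; first exact/mF/(agree_leq _ ab)/leq_maxl.
    by rewrite copyb //; apply/mp/(agree_leq _ ab)/leq_maxr.
  - have [e /existsNP[t /existsNP[k /not_implyP[etn /not_implyP[kn ne]]]]] :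
        exists e, ~ forall t k, (rank e + size t)%N = n -> (k < n)%N ->
        lab a e t k = c e t k.
      exact/existsNP.
    exists (vidx e t k).+1 => b ab [_ [closeb _]]; apply: ne.
    by rewrite -closeb // /lab /= ab.
  - have [s /not_implyP[sn /existsNP[m nS]]] := (existsNP _).2 nK.
    have [m1 m1S] := Slocal m (wit a s).
    have [m2 m2S] := agree_reindex (sidx s) m1.
    have [m3 m3S] := baire_continuous_reindex (vidx None s) p_continuous
      (open_nbhs_nbhs (conj (closed_openC (Sclosed m (wit a s))) nS)).
    exists (maxn m2 m3) => b ab [_ [_ /(_ s sn m)]].
    rewrite (m1S (wit b s)); last exact/m2S/(agree_leq _ ab)/leq_maxl.
    exact/m3S/(agree_leq _ ab)/leq_maxr.
have [|B [bB KB BF]] := borel_independent_extension pX Kclosed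
    (@baire_continuous_reindex _ p (vidx None (rev (s_word hd n))) p_continuous)
    F_continuous.
  move=> b a Ka; apply: (Fh (fun i => lab (a i)) b) => i.
  have [copya [closea Sa]] := Ka i; split=> //; split=> // s sn.
  suff : (~` C) (p (lab (a i) None s)) by [].
  by rewrite SE; exists (wit (a i) s) => m; apply: Sa.
exists B; split=> // h copyh closeh nC.
have /choice[w wP] : forall s, exists w, size s = n -> forall m, S m w (p (h None s)).
  move=> s; have [sn|ns] := pselect (size s = n); last by exists id.
  by have : (~` C) (p (h None s)) := nC s sn; rewrite SE => -[w wS]; exists w.
pose a m := match @unpickle index m with
  | Some (inl (o, t, k)) => h o t k | Some (inr (s, k)) => w s k | None => 0%N end.
have labE : lab a = h.
  by apply/funext => o; apply/funext => t; apply/funext => k; rewrite /lab /a /= pickleK.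
have witE : wit a = w.
  by apply/funext => s; apply/funext => k; rewrite /wit /a /= pickleK.
have -> : p (h None (rev (s_word hd n))) = p (lab a None (rev (s_word hd n))).
  by rewrite labE.
by apply: KB; rewrite /K /= labE witE.
Qed.

(** If the sets [B j] witnessed that the successors are small, [d] copies near [c]
    avoiding all of them could not be joined by a hyperedge at [s_n], since the
    result would be a successor avoiding the [B j]. One more Borel independent set
    then takes care of all these copies. *)
Lemma large_successor n c :
  ~ small n (is_copy n `&` close_copy n c) ->
  ~ small n.+1 (is_copy n.+1 `&` [set h | forall i, close_copy n c (child i h)]).
Proof.
move=> largec [B [cB BH]]; apply: largec.
have bB : borel_set (\bigcup_j B j) by apply: borel_bigcup => j; have [] := cB j.
have [|B' [cB' BH']] := @avoiding_image_extension n c _ bB.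
  move=> hs b hsP; apply: contrapT => /forallNP noi.
  have [|j [[|i s] [//= sn Bs]]] := BH (join hs b).
    split; last by move=> i; have [_ []] := hsP i.
    by apply: join_copy => i; [have [] := hsP i|apply: contrapT (noi i)].
  by have [_ [_ /(_ s)]] := hsP i; apply; [case: sn|exists j].
exists (fun j => if j is j'.+1 then B j' else B'); split=> [[|j] //|h [copyh closeh]].
have [[s [sn [j _ Bs]]]|noC] :=
    pselect (exists s, size s = n /\ (\bigcup_j B j) (p (h None s))).
  by exists j.+1, s.
exists 0%N, (rev (s_word hd n)); rewrite size_rev size_s_word; split=> //.
by apply: BH' => // s sn Cs; apply: noC; exists s.
Qed.

(** Each step passes to the next level, then fixes the values of finitely many
    coordinates so that they stay the same from there on. *)
Lemma large_sequence :
  ~ small 0 setT ->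
  exists c : nat -> labelling, forall n,
    is_copy n (c n) /\ forall i, close_copy n (c n) (child i (c n.+1)).
Proof.
move=> large0.
have [c cP] : exists c : nat -> labelling, forall n,
    (is_copy n (c n) /\ ~ small n (is_copy n `&` close_copy n (c n))) /\
    forall i, close_copy n (c n) (child i (c n.+1)).
  apply: (@dependent_choice_nat _
    (fun n c => is_copy n c /\ ~ small n (is_copy n `&` close_copy n c))
    (fun n c c' => forall i, close_copy n c (child i c')) (fun _ _ _ => 0%N)).
    split=> [k t|]; first by rewrite addSn.
    apply: contra_not large0; apply: small_subset => h _.
    by split=> [k t|o t k _]; rewrite ?addSn ?ltn0.
  move=> n c [copyc largec]; have [L LP] := finite_level n.+1.
  have [c' [copyc' closec'] largec'] := large_refine L (large_successor largec).
  exists c' => //; split=> //; apply: contra_not largec'; apply: small_subset.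
  move=> h [[copyh _] hL]; split=> // o t k otn kn.
  by apply: hL; apply: LP.
by exists c => n; have [[]] := cP n.
Qed.

End Construction.

(** * The limit of a coherent sequence of copies *)

Section Limit.
Context (R : realType) (d : nat) (hd : (2 <= d)%N) (X : topologicalType).
Hypothesis pX : polish R X.
Context (p : (nat -> nat) -> X) (F : (nat -> nat) -> power d X).
Hypothesis p_continuous : baire_continuous p.
Hypothesis F_continuous : forall i, baire_continuous (fun b => F b i).
Context (c : nat -> labelling d).
Hypothesis c_copy : forall n, is_copy hd p F n (c n).
Hypothesis c_coherent : forall n i, close_copy n (c n) (child i (c n.+1)).

(** The eventual value of the coordinates indexed by the prefixes of [g], read
    where each of its terms has already settled. *)
Definition branch (g : infinite_words d) (o : option nat) : nat -> nat :=
  fun k => c (rank o + k.+1) o (rev (mkseq g k.+1)) k.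

Lemma branch_agree g o m : agree m (c (rank o + m) o (rev (mkseq g m))) (branch g o).
Proof.
apply: (@agree_diagonal (fun m => c (rank o + m) o (rev (mkseq g m)))) => n k kn.
rewrite mkseqS rev_rcons addnS; symmetry; apply: c_coherent.
  by rewrite size_rev size_mkseq.
exact: leq_trans kn (leq_addl _ _).
Qed.

(** The equation holds in all the copies, and both sides depend continuously on
    their codes. *)
Lemma branch_edge g n i :
  F (branch g (Some n)) i =
  p (branch (concat (rcons (s_word hd n) i) g) None).
Proof.
apply: contrapT => /(polish_separated pX)[U [V [oU UF oV Vp UV]]].
have [m mF] := F_continuous (open_nbhs_nbhs (conj oU UF)).
have [m' mp] := p_continuous (open_nbhs_nbhs (conj oV Vp)).
pose M := maxn m m'; pose w := rev (mkseq g M).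
suff : (U `&` V) (F (c (n.+1 + M) (Some n) w) i) by rewrite UV.
split; first by apply/mF/(agree_leq (leq_maxl m m'))/agree_sym/(branch_agree g (Some n)).
rewrite c_copy ?size_rev ?size_mkseq //.
have -> : w ++ i :: rev (s_word hd n) =
    rev (mkseq (concat (rcons (s_word hd n) i) g) (n.+1 + M)).
  have -> : (n.+1 + M = size (rcons (s_word hd n) i) + M)%N.
    by rewrite size_rcons size_s_word.
  by rewrite mkseq_concat (rev_cat (rcons _ _)) rev_rcons.
apply: mp; apply: (@agree_leq _ (n.+1 + M)).
  exact: leq_trans (leq_maxr m m') (leq_addl _ _).
exact/agree_sym/(branch_agree _ None).
Qed.

Lemma branch_reduces : continuously_reduces (A_set hd) (range F).
Proof.
exists (fun g => p (branch g None)) => [g U /p_continuous[m pm]|x].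
  apply/nbhs_words; exists m => g' E; apply: pm => k km.
  by rewrite /branch -(take_mkseq _ km) -[in RHS](take_mkseq _ km) E.
move=> [n [g ->]]; exists (branch g (Some n)) => //.
by apply/funext => i; apply: branch_edge.
Qed.

End Limit.

(** * Borel colourings from countable covers *)

Lemma coloring_reduces (d : nat) (hd : (2 <= d)%N) (X : topologicalType)
    (F : (nat -> nat) -> power d X) (B : nat -> set X) :
  (forall j, borel_independent F (B j)) -> (forall x, exists j, B j x) ->
  borel_reduces (range F) (~` @diagonal_power d hd nat).
Proof.
move=> cB covB.
pose u x := ex_minn (let: ex_intro j Bj := covB x in
  ex_intro (fun j => `[< B j x >]) j (asboolT Bj)).
have uB x : B (u x) x by rewrite /u; case: ex_minnP => j /asboolP.
have umin x j : B j x -> (u x <= j)%N.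
  by move=> Bj; rewrite /u; case: ex_minnP => k _; apply; apply/asboolP.
exists u => [S _|_ [b _ <-] ub].
  have -> : u @^-1` S = \bigcup_j (if j \in S then
      B j `&` \bigcap_k (if (k < j)%N then ~` B k else setT) else set0).
    apply/seteqP; split=> x /=.
      move=> Sx; exists (u x) => //; rewrite mem_set //; split=> // k _.
      by case: ifP => // ku Bk; have := umin _ _ Bk; rewrite leqNgt ku.
    move=> [j _]; case: ifP => // /set_mem Sj [Bj Bk].
    suff -> : u x = j by [].
    apply/eqP; rewrite eqn_leq umin // leqNgt; apply/negP => uj.
    by have := Bk (u x) I; rewrite uj; apply.
  apply: borel_bigcup => j; case: ifP => _; last by apply: borel_open; exact: open0.
  have -> : B j `&` \bigcap_k (if (k < j)%N then ~` B k else setT) =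
      \bigcap_(o : option nat) if o is Some k then
        (if (k < j)%N then ~` B k else setT) else B j.
    apply/seteqP; split=> x.
      by move=> [Bj Bk] [k|] _ //; apply: Bk.
    by move=> H; split=> [|k _]; [exact: (H None)|exact: (H (Some k))].
  apply: borel_bigcap => -[k|]; last by have [] := cB j.
  case: ifP => _; last by apply: borel_open; exact: openT.
  by apply: borel_setC; have [] := cB k.
have [_ /(_ b)[i]] := cB (u (F b (Defs.zero hd))); apply.
by rewrite -[X in B X]/(map_power u (F b) _) -(ub i); apply: uB.
Qed.

(** * Baire category on infinite words *)

Section Category.
Context (d : nat).
Hypothesis d_gt0 : (0 < d)%N.
Local Notation word := (seq 'I_d).

(** [D n] stands for the open set of the sequences with a prefix in [D n]; the
    first condition says that this open set is dense. *)
Definition comeager (P : set (infinite_words d)) := exists D : nat -> set word,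
  (forall n r, exists r', D n (r ++ r')) /\
  forall g, (forall n, exists m, D n (mkseq g m)) -> P g.

(** The trace of [P] on the cone of [s], transported to the whole space, so that
    being comeager in a cone needs no separate definition. *)
Definition below (s : word) (P : set (infinite_words d)) := concat s @^-1` P.

Definition baire_property (P : set (infinite_words d)) := forall s, exists r,
  comeager (below (s ++ r) P) \/ comeager (below (s ++ r) (~` P)).

Lemma below_cat s t P : below (s ++ t) P = below t (below s P).
Proof. by apply/seteqP; split=> g; rewrite /below /= concat_cat. Qed.

Lemma comeager_subset (P Q : set (infinite_words d)) :
  P `<=` Q -> comeager P -> comeager Q.
Proof. by move=> PQ [D [Dd DP]]; exists D; split=> // g /DP /PQ. Qed.

Lemma comeagerT : comeager setT.
Proof. by exists (fun _ _ => True); split=> // _ r; exists [::]. Qed.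

(** The Baire category theorem. *)
Lemma comeager_nonempty P : comeager P -> P !=set0.
Proof.
move=> [D [Dd DP]]; pose w0 : 'I_d := Ordinal d_gt0.
have [s sP] : exists s : nat -> word, forall n, (n <= size (s n))%N /\
    exists2 r, D n (s n ++ r) & prefix (s n ++ r) (s n.+1).
  apply: (@dependent_choice_nat _ (fun n s => (n <= size s)%N)
    (fun n s s' => exists2 r, D n (s ++ r) & prefix (s ++ r) s') [::]) => //.
  move=> n s ns; have [r Dr] := Dd n s.
  exists (rcons (s ++ r) w0).
    by rewrite size_rcons size_cat ltnS (leq_trans ns) ?leq_addr.
  by exists r => //; rewrite -cats1 prefix_prefix.
have sS n : prefix (s n) (s n.+1).
  by have [_ [r _]] := sP n; apply: prefix_trans; apply: prefix_prefix.
have sle n m : (n <= m)%N -> prefix (s n) (s m).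
  by move=> /subnK <-; elim: (m - n)%N => [|k IH];
    [exact: prefix_refl|exact: prefix_trans (sS _)].
pose g : infinite_words d := fun k => nth w0 (s k.+1) k.
have gs n : mkseq g (size (s n)) = s n.
  apply: (@eq_from_nth _ w0) => [|k]; rewrite size_mkseq // => kn.
  rewrite nth_mkseq // /g.
  have [/sle/prefixP[t ->]|/ltnW/sle/prefixP[t E]] := leqP n k.+1.
    by rewrite nth_cat kn.
  by rewrite E nth_cat (leq_trans _ (sP k.+1).1).
exists g; apply: DP => n; have [_ [r Dr /prefixP[t E]]] := sP n.
exists (size (s n ++ r)); suff -> : mkseq g (size (s n ++ r)) = s n ++ r by [].
have := gs n.+1; rewrite {1}E (size_cat _ t).
move/(congr1 (take (size (s n ++ r)))); rewrite [in RHS]E take_size_cat //.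
by rewrite take_mkseq // leq_addr.
Qed.

Lemma comeager_bigcap (I : countType) (P : I -> set (infinite_words d)) :
  (forall j, comeager (P j)) -> comeager (\bigcap_j P j).
Proof.
move=> /choice[D DP].
exists (fun n w => if @unpickle (I * nat)%type n is Some (j, k) then D j k w else True).
split=> [n r|g Dg j _].
  case: unpickle => [[j k]|]; last by exists [::].
  by have [+ _] := DP j; apply.
have [_] := DP j; apply=> k.
by have := Dg (pickle (j, k)); rewrite pickleK.
Qed.

Lemma comeager_below s P : comeager P -> comeager (below s P).
Proof.
move=> [D [Dd DP]]; exists (fun n w => D n (s ++ w)); split=> [n r|g Dg].
  by have [r'] := Dd n (s ++ r); rewrite -catA; exists r'.
apply: DP => n; have [m Dm] := Dg n.
by exists (size s + m)%N; rewrite mkseq_concat.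
Qed.

(** A set that is comeager in a dense family of cones is comeager. The dense open
    sets of a single cone are made dense in the whole space by adding all words
    incompatible with that cone, and one more dense open set forces a sequence
    into some cone. *)
Lemma comeager_local P :
  (forall s, exists r, comeager (below (s ++ r) P)) -> comeager P.
Proof.
move=> /choice[r rP]; have /choice[D DP] := rP.
pose t s := s ++ r s.
pose E (o : option (word * nat)) : set word :=
  if o is Some (s, n) then
    [set w | (~~ prefix (t s) w /\ ~~ prefix w (t s)) \/
             exists2 w', w = t s ++ w' & D s n w']
  else [set w | exists s w', w = t s ++ w'].
exists (fun m => if @unpickle (option (word * nat)) m is Some o then E o else setT).
split=> [m w|g Eg].
  case: unpickle => [[[s n]|]|]; last by exists [::].
    have [Ds _] := DP s.
    have [/prefixP[w' ->]|ntw] := boolP (prefix (t s) w).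
      by have [r' Dr'] := Ds n w'; exists r'; right; exists (w' ++ r'); rewrite ?catA.
    have [/prefixP[w' E']|nwt] := boolP (prefix w (t s)); last first.
      by exists [::]; rewrite cats0; left.
    have [r' Dr'] := Ds n [::]; exists (w' ++ r'); right; exists r' => //.
    by rewrite catA -E'.
  by exists (r w), w, [::]; rewrite cats0.
have [m] := Eg (pickle (None : option (word * nat))); rewrite pickleK => -[s [w' gE]].
pose g' : infinite_words d := fun k => g (size (t s) + k)%N.
have gt : mkseq g (size (t s)) = t s.
  have := congr1 (take (size (t s))) gE; rewrite take_size_cat //.
  have lem : (size (t s) <= m)%N.
    by have := congr1 size gE; rewrite size_mkseq size_cat => ->; rewrite leq_addr.
  by rewrite take_mkseq.
have gcat : g = concat (t s) g' by have := concat_mkseq g (size (t s)); rewrite gt.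
have [_ sP] := DP s; rewrite gcat; apply: sP => n.
have [k] := Eg (pickle (Some (s, n))); rewrite pickleK => -[[/negP n1 /negP n2]|].
  have [tk|/ltnW kt] := leqP (size (t s)) k; exfalso.
    apply: n1; rewrite gcat -(subnKC tk) mkseq_concat; exact: prefix_prefix.
  apply: n2; rewrite -gt -(take_mkseq _ kt); exact: prefix_take.
move=> [v E' Dv]; exists (size v).
suff -> : mkseq g' (size v) = v by [].
have kE : k = (size (t s) + size v)%N.
  by have := congr1 size E'; rewrite size_mkseq size_cat.
have := E'; rewrite kE gcat mkseq_concat => /eqP.
by rewrite eqseq_cat // => /andP[_ /eqP].
Qed.

Lemma baire_property_setC P : baire_property P -> baire_property (~` P).
Proof.
move=> PP s; have [r [cr|cr]] := PP s; exists r; last by left.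
by right; rewrite setCK.
Qed.

Lemma comeager_setC_bigcup (P : nat -> set (infinite_words d)) :
  (forall n, baire_property (P n)) ->
  (forall n s, ~ comeager (below s (P n))) -> comeager (~` \bigcup_n P n).
Proof.
move=> PP nP; rewrite setC_bigcup; apply: comeager_bigcap => n.
by apply: comeager_local => s; have [r [/nP//|cr]] := PP n s; exists r.
Qed.

(** Below a word where no [P n] is comeager in any cone, each complement is
    comeager, hence so is the complement of the union. *)
Lemma baire_property_bigcup (P : nat -> set (infinite_words d)) :
  (forall n, baire_property (P n)) -> baire_property (\bigcup_n P n).
Proof.
move=> PP s.
have [[n [r cr]]|nP] := pselect (exists n r, comeager (below (s ++ r) (P n))).
  by exists r; left; apply: comeager_subset cr => g Pg; exists n.
exists [::]; right; rewrite cats0.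
have -> : below s (~` \bigcup_n P n) = ~` \bigcup_n below s (P n) by [].
apply: comeager_setC_bigcup => [n r|n r cr]; last first.
  by apply: nP; exists n, r; rewrite below_cat.
have [r' [cr|cr]] := PP n (s ++ r); exists r'; [left|right].
  by rewrite -catA below_cat in cr.
by rewrite -catA below_cat in cr.
Qed.

Lemma baire_property_preimage (X : topologicalType) (u : infinite_words d -> X) B :
  continuous u -> borel_set B -> baire_property (u @^-1` B).
Proof.
move=> uc; elim/borel_set_ind => {B} [U oU|B PB|B PB].
- move=> s; have [[g Ug]|nU] := pselect (exists g, U (u (concat s g))); last first.
    exists [::]; right; rewrite cats0; apply: comeager_subset comeagerT => g _ Ug.
    by apply: nU; exists g.
  have /uc/nbhs_words[m mU] : nbhs (u (concat s g)) U by apply: open_nbhs_nbhs.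
  exists (mkseq g m); left; apply: comeager_subset comeagerT => g' _; apply: mU => /=.
  have m_le : (m <= size s + m)%N by rewrite leq_addl.
  rewrite -(take_mkseq _ m_le) -[in RHS](take_mkseq _ m_le) concat_cat !mkseq_concat.
  by rewrite -[m in mkseq _ m](size_mkseq g) -[size _]addn0 mkseq_concat cats0.
- exact: baire_property_setC.
- by rewrite preimage_bigcup; apply: baire_property_bigcup.
Qed.

End Category.

(** * The dichotomy *)

Lemma borel_coloring_obstruction (d : nat) (hd : (2 <= d)%N) (X : topologicalType)
    (u : infinite_words d -> X) (v : X -> nat) :
  continuous u -> borel_map v ->
  exists x, A_set hd x /\ forall i, v (u (x i)) = v (u (x (Defs.zero hd))).
Proof.
move=> uc vb; pose P k := u @^-1` (v @^-1` [set k]).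
have PP k : baire_property (P k).
  apply: baire_property_preimage => //; apply: vb; apply: borel_open.
  exact: discrete_open.
have [k [s cs]] : exists k s, comeager (below s (P k)).
  apply: contrapT => noP.
  have nP n s : ~ comeager (below s (P n)) by move=> cs; apply: noP; exists n, s.
  have [g] := comeager_nonempty (ltnW hd) (comeager_setC_bigcup PP nP).
  by apply; exists (v (u g)).
have [n [r snE]] := s_word_dense hd s.
have cap : comeager (\bigcap_i below (rcons (s_word hd n) i) (P k)).
  apply: comeager_bigcap => i.
  by rewrite snE rcons_cat below_cat; apply: comeager_below.
have [g Pg] := comeager_nonempty (ltnW hd) cap.
exists (fun i => concat (rcons (s_word hd n) i) g); split; first by exists n, g.
by move=> i; rewrite (Pg i I) (Pg (Defs.zero hd) I).
Qed.

Lemma dichotomy_baire_image (R : realType) (d : nat) (hd : (2 <= d)%N)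
    (X : topologicalType) (F : (nat -> nat) -> power d X) :
  polish R X -> (forall i, baire_continuous (fun b => F b i)) ->
  borel_reduces (range F) (~` @diagonal_power d hd nat) \/
  continuously_reduces (A_set hd) (range F).
Proof.
move=> pX Fc; have [p [pc psurj]] := polish_baire_image (F (fun=> 0%N) (Defs.zero hd)) pX.
have [[B [cB BT]]|large] := pselect (small p F 0 setT); [left|right].
  apply: (coloring_reduces hd cB) => x; have [a <-] := psurj x.
  by have [j [s [_ Bj]]] := BT (fun _ _ => a) I; exists j.
have [c cP] := large_sequence hd pX pc Fc large.
by apply: (@branch_reduces R d hd X pX p F pc Fc c) => n; have [] := cP n.
Qed.

Theorem theorem1p4 (R : realType) (d : nat) (hd : (2 <= d)%N)
    (X : topologicalType) (hX : polish R X)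
    (A : set (power d X)) (hA : analytic R A) :
  let a := borel_reduces A (~` @diagonal_power d hd nat) in
  let b := continuously_reduces (A_set hd) A in
  (a \/ b) /\ ~ (a /\ b).
Proof.
move=> a b; split; last first.
  move=> [[v vb vA] [u uc uA]].
  have [x [/uA Ax vx]] := borel_coloring_obstruction hd uc vb.
  exact: (vA _ Ax) vx.
have [Y [f [pY fc AE]]] := hA.
have [y0|noY] := pselect (exists y : Y, True); last first.
  left; exists (fun=> 0%N) => [S bS|x]; last first.
    by rewrite AE => -[y _ _]; case: noY; exists y.
  have [S0|nS0] := pselect (S 0%N).
    have -> : (fun=> 0%N) @^-1` S = [set: X] by apply/seteqP; split=> x.
    by apply: borel_open; exact: openT.
  have -> : (fun=> 0%N) @^-1` S = @set0 X by apply/seteqP; split=> x.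
  by apply: borel_open; exact: open0.
have [y _] := y0; have [q [qc qsurj]] := polish_baire_image y pY.
have AE' : A = range (f \o q).
  rewrite AE; apply/seteqP; split=> [_ [z _ <-]|_ [e _ <-]]; last by exists (q e).
  by have [e <-] := qsurj z; exists e.
rewrite /a /b AE'; apply: (dichotomy_baire_image hd (F := f \o q) hX) => i.
apply: (baire_continuous_comp (g := fun y => f y i) qc) => z U Uz.
exact: (fc z _ (@proj_continuous _ (fun=> X) i (f z) U Uz)).
Qed.
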